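(* Let $\ell\ge0$ and $|m|\le\ell$ be integers, and let $y\in(-1,1)$, $\phi\in\mathbb{R}$. (1) The real spherical harmonics $Y_{\ell,m}=Y_{\ell,m}(y,\phi)$ satisfy $$I_{0}Y_{\ell,m}=\frac{1}{2\ell+1}\left(h_{\ell+1,m}Y_{\ell+1,m}+h_{\ell,m}Y_{\ell-1,m}\right),$$ $$I_{1}Y_{\ell,m}=\frac{1}{2(2\ell+1)}\left(\check{s}_{m}(\tilde{h}_{\ell+1,-m}Y_{\ell+1,m-1}-\tilde{h}_{\ell-1,m}Y_{\ell-1,m-1})-\hat{s}_{m}(\tilde{h}_{\ell+1,m}Y_{\ell+1,m+1}-\tilde{h}_{\ell-1,-m}Y_{\ell-1,m+1})\right),$$ $$I_{2}Y_{\ell,m}=\frac{1}{2(2\ell+1)}\left(s_{m}(\tilde{h}_{\ell-1,-m}Y_{\ell-1,-m-1}-\tilde{h}_{\ell+1,m}Y_{\ell+1,-m-1})+\tilde{s}_{m}(\tilde{h}_{\ell-1,m}Y_{\ell-1,-m+1}-\tilde{h}_{\ell+1,-m}Y_{\ell+1,-m+1})\right).$$ (2) Their partial derivatives satisfy (with $\frac{d}{dy}$ the derivative in $y$ at fixed $\phi$) $$\tilde{I}_{0}\tfrac{d}{dy}Y_{\ell,m}-\ell I_{0}Y_{\ell,m}=-h_{\ell,m}Y_{\ell-1,m},$$ $$\tilde{I}_{0}\tfrac{d}{dy}Y_{\ell,m}+(\ell+1)I_{0}Y_{\ell,m}=h_{\ell+1,m}Y_{\ell+1,m},$$ $$\tilde{I}_{1}\tfrac{d}{dy}Y_{\ell,m}-\ell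 I_{1}Y_{\ell,m}-m\hat{I}_{1}Y_{\ell,-m}=\tfrac{1}{2}\left(\check{s}_{m}\tilde{h}_{\ell-1,m}Y_{\ell-1,m-1}-\hat{s}_{m}\tilde{h}_{\ell-1,-m}Y_{\ell-1,m+1}\right),$$ $$\tilde{I}_{2}\tfrac{d}{dy}Y_{\ell,m}-\ell I_{2}Y_{\ell,m}-m\hat{I}_{2}Y_{\ell,-m}=-\tfrac{1}{2}\left(\tilde{s}_{m}\tilde{h}_{\ell-1,m}Y_{\ell-1,-m+1}+s_{m}\tilde{h}_{\ell-1,-m}Y_{\ell-1,-m-1}\right),$$ $$\tilde{I}_{1}\tfrac{d}{dy}Y_{\ell,m}+(\ell+1)I_{1}Y_{\ell,m}-m\hat{I}_{1}Y_{\ell,-m}=\tfrac{1}{2}\left(\check{s}_{m}\tilde{h}_{\ell+1,-m}Y_{\ell+1,m-1}-\hat{s}_{m}\tilde{h}_{\ell+1,m}Y_{\ell+1,m+1}\right),$$ $$\tilde{I}_{2}\tfrac{d}{dy}Y_{\ell,m}+(\ell+1)I_{2}Y_{\ell,m}-m\hat{I}_{2}Y_{\ell,-m}=-\tfrac{1}{2}\left(\tilde{s}_{m}\tilde{h}_{\ell+1,-m}Y_{\ell+1,-m+1}+s_{m}\tilde{h}_{\ell+1,m}Y_{\ell+1,-m-1}\right),$$ $$I_{1}\tfrac{d}{dy}Y_{\ell,m}-m\hat{I}_{3}Y_{\ell,-m}=\tfrac{1}{2}\left(\check{s}_{m}\hat{h}_{\ell,m}Y_{\ell,m-1}-\hat{s}_{m}\hat{h}_{\ell,-m}Y_{\ell,m+1}\right),$$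 $$I_{2}\tfrac{d}{dy}Y_{\ell,m}-m\hat{I}_{4}Y_{\ell,-m}=-\tfrac{1}{2}\left(\tilde{s}_{m}\hat{h}_{\ell,m}Y_{\ell,-m+1}+s_{m}\hat{h}_{\ell,-m}Y_{\ell,-m-1}\right).$$
   Context: Associated Legendre functions: for $0\le m\le\ell$, $\hat{P}_{\ell}^{m}(y)=(-1)^{m}(1-y^2)^{m/2}\frac{1}{2^{\ell}\ell!}\frac{d^{\ell+m}}{dy^{\ell+m}}(y^2-1)^{\ell}$ and $\check{P}_{\ell}^{m}=\sqrt{\frac{(\ell-m)!}{(\ell+m)!}}\hat{P}_{\ell}^{m}$. Real spherical harmonics: $Y_{\ell,m}(y,\phi)=\sqrt2\,\check P_\ell^{|m|}(y)\sin(|m|\phi)$ if $m<0$, $Y_{\ell,0}=\check P_\ell^0(y)$, $Y_{\ell,m}=\sqrt2\,\check P_\ell^{m}(y)\cos(m\phi)$ if $m>0$. Convention: $Y_{\ell,m}=0$ if $|m|>\ell$ or $\ell=-1$. Functions of $(y,\phi)$: $I_{0}=y$, $I_{1}=\sqrt{1-y^2}\cos\phi$, $I_{2}=\sqrt{1-y^2}\sin\phi$, $\tilde I_0=y^2-1$, $\tilde I_1=y\sqrt{1-y^2}\cos\phi$, $\tilde I_2=y\sqrt{1-y^2}\sin\phi$, $\hat I_1=(1-y^2)^{-1/2}\sin\phi$, $\hat I_2=-(1-y^2)^{-1/2}\cos\phi$, $\hat I_3=y(1-y^2)^{-1/2}\sin\phi$, $\hat I_4=-y(1-y^2)^{-1/2}\cos\phi$.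 Constants: $h_{\ell,m}=\sqrt{(\ell+m)(\ell-m)}$; $\tilde h_{\ell-1,m}=\sqrt{(\ell+m-1)(\ell+m)}$, i.e. $\tilde h_{j,m}=\sqrt{(j+m)(j+m+1)}$ for every first index $j$ (so $\tilde h_{\ell+1,m}=\sqrt{(\ell+m+1)(\ell+m+2)}$); $\hat h_{\ell,m}=\sqrt{(\ell+m)(\ell-m+1)}$. With $\mathrm{sign}(m)=1$ for $m\ge0$, $-1$ for $m<0$, and $\delta$ the Kronecker delta: $s_m=\mathrm{sign}(m)\sqrt{\delta_{m,-1}+\delta_{m,0}+1}$, $\tilde s_m=\mathrm{sign}(m)(1-\delta_{m,0})(1-\delta_{m,1})$, $\hat s_m=\mathrm{sign}(m)(1-\delta_{m,-1})\sqrt{\delta_{m,0}+1}$, $\check s_m=\mathrm{sign}(m)(1-\delta_{m,0})\sqrt{\delta_{m,1}+1}$. *)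

(* Defs.v *)
From HB Require Import structures.
From mathcomp Require Export all_boot all_order all_algebra.
From mathcomp Require Export all_classical all_reals all_analysis.
Export Order.TTheory GRing.Theory Num.Theory numFieldNormedType.Exports.

Set Implicit Arguments.
Unset Strict Implicit.
Unset Printing Implicit Defensive.

Local Open Scope ring_scope.

(* Associated Legendre functions. [derive1n k f] is the k-th derivative of the
   real function [f], and [`^] is the power with real exponent. *)
Definition Phat {R : realType} (l m : nat) (y : R) : R :=
  (-1) ^+ m * (1 - y ^+ 2) `^ (m%:R / 2) * (1 / (2 ^+ l * l`!%:R)) *
  derive1n (l + m) (fun t : R => (t ^+ 2 - 1) ^+ l) y.

Definition Pcheck {R : realType} (l m : nat) (y : R) : R :=
  Num.sqrt ((l - m)`!%:R / (l + m)`!%:R) * Phat l m y.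

(* Real spherical harmonics. The degree is an integer, so that [Y (l - 1) m]
   makes sense for [l = 0]: the outer test yields 0 there, and more generally
   whenever |m| > l. *)
Definition Y {R : realType} (l m : int) (y phi : R) : R :=
  if `|m| <= l then
    if m < 0 then
      Num.sqrt 2 * Pcheck `|l|%N `|m|%N y * sin (`|m|%:~R * phi)
    else if m == 0 then Pcheck `|l|%N 0 y
    else Num.sqrt 2 * Pcheck `|l|%N `|m|%N y * cos (m%:~R * phi)
  else 0.

Definition dY {R : realType} (l m : int) (y phi : R) : R :=
  derive1 (fun t : R => Y l m t phi) y.

Section Multipliers.
Context {R : realType}.
Implicit Types y phi : R.

Definition I0 y phi : R := y.
Definition I1 y phi : R := Num.sqrt (1 - y ^+ 2) * cos phi.
Definition I2 y phi : R := Num.sqrt (1 - y ^+ 2) * sin phi.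

Definition Itilde0 y phi : R := y ^+ 2 - 1.
Definition Itilde1 y phi : R := y * Num.sqrt (1 - y ^+ 2) * cos phi.
Definition Itilde2 y phi : R := y * Num.sqrt (1 - y ^+ 2) * sin phi.

Definition Ihat1 y phi : R := (1 - y ^+ 2) `^ (- (1 / 2)) * sin phi.
Definition Ihat2 y phi : R := - (1 - y ^+ 2) `^ (- (1 / 2)) * cos phi.
Definition Ihat3 y phi : R := y * (1 - y ^+ 2) `^ (- (1 / 2)) * sin phi.
Definition Ihat4 y phi : R := - y * (1 - y ^+ 2) `^ (- (1 / 2)) * cos phi.

End Multipliers.

Section Constants.
Context {R : realType}.
Implicit Types l m : int.

Definition h l m : R := Num.sqrt ((l + m) * (l - m))%:~R.
Definition htilde l m : R := Num.sqrt ((l + m) * (l + m + 1))%:~R.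
Definition hhat l m : R := Num.sqrt ((l + m) * (l - m + 1))%:~R.

(* Unlike [Num.sg], this sign is 1 at 0. *)
Definition sign m : R := if 0 <= m then 1 else -1.
Definition delta (m n : int) : R := (m == n)%:R.

Definition s m : R := sign m * Num.sqrt (delta m (-1) + delta m 0 + 1).
Definition stilde m : R := sign m * (1 - delta m 0) * (1 - delta m 1).
Definition shat m : R :=
  sign m * (1 - delta m (-1)) * Num.sqrt (delta m 0 + 1).
Definition scheck m : R :=
  sign m * (1 - delta m 0) * Num.sqrt (delta m 1 + 1).

End Constants.

(* Main.v *)
Require Import Defs.
From mathcomp Require Import ring lra zify.

Local Open Scope ring_scope.

(** With P_l the Legendre polynomial and w = sqrt (1 - y^2), the associated
    Legendre function is (-1)^m w^m P_l^(m)(y). Applying Leibniz's rule to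
    (u^(l+1))' = 2(l+1) X u^l, where u = X^2 - 1, gives two contiguity relations
    between the derivatives of P_l and of P_(l+1), [legd_up] and [legd_down].
    Every other polynomial identity used below, including Legendre's
    differential equation [legd_ode], is an algebraic consequence of these two.

    They yield eight first-order ladder relations for the associated Legendre
    functions. Six come in pairs: for a function C built from P_l^m and its
    derivative, and a multiple D of P_l^m, C + m D is a multiple of a function
    of order m + 1 and C - m D a multiple of one of order m - 1, the degree
    being l, l + 1 or l - 1. The other two keep the order and change the degree.
    Normalisation ([Pcheck_raise] and the lemmas after it) turns the integer
    coefficients into the square roots [h], [htilde] and [hhat], because the
    normalising factor depends only on the factorials of l - m and l + m, whose
    indices move by at most two.

    A real spherical harmonic is a normalised function of |m| times a factor
    [azimuth m] of phi. Multiplying that factor by cos phi or sin phi shifts m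
    by one on either side, by the addition formulas; [ladder_trig] combines this
    with a pair of ladder relations once and for all, and the
    constants [scheck], [shat], [stilde] and [s] are exactly the outcome of its
    case distinction on m. This proves six of the eight derivative identities;
    the other two are the ladder relations that keep the order. Each product
    identity is the difference between the identity raising the degree and the
    one lowering it: the derivative cancels, and l + 1 and l add up to
    2l + 1. *)

(** * Derivatives of the Legendre polynomials *)

Lemma derivnXM (R : comNzRingType) (p : {poly R}) (n : nat) :
  ('X * p)^`(n.+1) = 'X * p^`(n.+1) + p^`(n) *+ n.+1.
Proof.
elim: n => [|n IH]; first by rewrite !derivn1 derivM derivX mul1r addrC.
by rewrite derivnS IH derivD derivM derivX derivMn -!derivnS mul1r; ring.
Qed.

Lemma derive1n_horner (R : realFieldType) (p : {poly R}) (n : nat) :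
  derive1n n (horner p) = horner p^`(n).
Proof. by elim: n => [|n IH] //; rewrite derive1nS IH derivnS derivE. Qed.

Section Legendre.
Context {R : realType}.
Implicit Types (l m : nat) (y : R).

Definition rodrigues l : {poly R} := ('X ^+ 2 - 1) ^+ l.

Definition rodrigues_cst l : R := 2 ^+ l * l`!%:R.

(** The [m]-th derivative at [y] of the Legendre polynomial of degree [l]. *)
Definition legd l m y : R := (rodrigues l)^`(l + m).[y] / rodrigues_cst l.

Lemma rodrigues_cst_neq0 l : rodrigues_cst l != 0.
Proof. by rewrite mulf_neq0 ?expf_neq0 ?pnatr_eq0 // -lt0n fact_gt0. Qed.

Lemma rodrigues_cstS l :
  rodrigues_cst l.+1 = (2 * l.+1)%:R * rodrigues_cst l.
Proof. by rewrite /rodrigues_cst factS exprS !natrM; ring. Qed.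

Lemma deriv_rodrigues l :
  (rodrigues l.+1)^`() = (2 * l.+1)%:R *: ('X * rodrigues l).
Proof.
rewrite /rodrigues deriv_exp derivB derivXn derivC subr0 /= scaler_nat.
by rewrite expr1 mulrnA mulrnAl.
Qed.

(** Since u = X^2 - 1, we have X (u^(l+1))' = 2(l+1) (u + 1) u^l; solving for
    u^l expresses a lower power through a higher one, which is what makes the
    relation [legd_down] possible. *)
Lemma rodrigues_lower l :
  (2 * l.+1)%:R *: rodrigues l =
  'X * (rodrigues l.+1)^`() - (2 * l.+1)%:R *: rodrigues l.+1 :> {poly R}.
Proof.
by rewrite deriv_rodrigues /rodrigues [_ ^+ l.+1]exprS !scaler_nat; ring.
Qed.

(** One derivative turns u^(l+1) into a multiple of X u^l, and for the factor X
    only two terms of Leibniz's rule survive. *)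
Lemma legd_up l m y :
  legd l.+1 m.+1 y = (l + m).+1%:R * legd l m y + y * legd l m.+1 y.
Proof.
have c0 := rodrigues_cst_neq0 l.
rewrite /legd rodrigues_cstS !addSn !addnS derivSn deriv_rodrigues derivnZ.
rewrite derivnXM hornerZ hornerD hornerM hornerX hornerMn -mulr_natl natrM.
set a := _.[y]; set b := _.[y]; field.
by rewrite c0 nat1r pnatr_eq0.
Qed.

Lemma legd_down l m y :
  legd l m.+1 y = y * legd l.+1 m.+1 y - (l.+1%:R - m%:R) * legd l.+1 m y.
Proof.
have c0 := rodrigues_cst_neq0 l.
have -> : legd l m.+1 y =
    ((2 * l.+1)%:R *: rodrigues l)^`(l + m.+1).[y] / rodrigues_cst l.+1.
  rewrite /legd rodrigues_cstS derivnZ hornerZ.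
  by set a := _.[y]; field; rewrite c0 nat1r pnatr_eq0.
rewrite rodrigues_lower derivnB derivnZ addnS derivnXM -!derivSn.
rewrite /legd !addSn !addnS.
rewrite hornerD hornerN hornerZ hornerD hornerM hornerX hornerMn -mulr_natl.
rewrite rodrigues_cstS.
set a := _.[y]; set b := _.[y]; field.
by rewrite c0 nat1r pnatr_eq0.
Qed.

(** Eliminating P_(l+1)^(m+1) between the two contiguity relations. *)
Lemma legd_climb l m y :
  (1 - y ^+ 2) * legd l m.+1 y =
  (l + m).+1%:R * y * legd l m y - (l.+1%:R - m%:R) * legd l.+1 m y.
Proof. by rewrite mulrBl mul1r {1}legd_down legd_up; ring. Qed.

(** Eliminating P_l^(m+1) between the two contiguity relations. *)
Lemma legd_descend l m y :
  (1 - y ^+ 2) * legd l.+1 m.+1 y =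
  (l + m).+1%:R * legd l m y - (l.+1%:R - m%:R) * y * legd l.+1 m y.
Proof. by rewrite mulrBl mul1r {1}legd_up legd_down; ring. Qed.

(** Legendre's differential equation differentiated [m] times: [legd_climb] at
    order [m + 1] involves P_(l+1)^(m+1), which [legd_up] brings back to
    degree [l]. *)
Lemma legd_ode l m y :
  (1 - y ^+ 2) * legd l m.+2 y =
  2 * m.+1%:R * y * legd l m.+1 y - (l%:R - m%:R) * (l + m).+1%:R * legd l m y.
Proof.
have h1 := legd_climb l m.+1 y; have h2 := legd_up l m y.
rewrite h1 h2 !addnS; ring.
Qed.

Lemma legd_gt l m y : (l < m)%N -> legd l m y = 0.
Proof.
move=> lm; rewrite /legd derivn_poly0 ?horner0 ?mul0r //.
rewrite /rodrigues; apply: leq_trans (size_poly_exp_leq _ _) _.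
by rewrite size_XnsubC //=; lia.
Qed.

Lemma is_derive_legd l m y : is_derive y 1 (legd l m) (legd l m.+1 y).
Proof.
have -> : legd l m = (rodrigues_cst l)^-1 \*: horner (rodrigues l)^`(l + m).
  by apply/funext => t; rewrite /legd mulrC.
rewrite /legd addnS derivnS mulrC.
exact: is_deriveZ.
Qed.
End Legendre.

(** * Associated Legendre functions *)

Section AssocLegendre.
Context {R : realType}.
Implicit Types (l m n : nat) (y : R).

Lemma onem_sqr_gt0 y : -1 < y -> y < 1 -> 0 < 1 - y ^+ 2.
Proof. by move=> y1 y2; nra. Qed.

Lemma PhatE l m y : -1 < y -> y < 1 ->
  Phat l m y = (-1) ^+ m * Num.sqrt (1 - y ^+ 2) ^+ m * legd l m y.
Proof.
move=> y1 y2; have w2 := onem_sqr_gt0 _ y1 y2.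
rewrite /Phat /legd /rodrigues_cst mulrC [m%:R / 2]mulrC powRrM.
rewrite powR12_sqrt ?ltW // powR_mulrn ?sqrtr_ge0 //.
have -> : (fun t : R => (t ^+ 2 - 1) ^+ l) = horner (rodrigues l).
  by apply/funext => t; rewrite /rodrigues !hornerE.
by rewrite derive1n_horner div1r; ring.
Qed.

(** With the derivative of [Phat l m] in closed form, the ladder relations
    become identities between derivatives of Legendre polynomials, w and y. *)
Definition dPhat l m y : R :=
  (-1) ^+ m * Num.sqrt (1 - y ^+ 2) ^+ m *
  (legd l m.+1 y - m%:R * y / (1 - y ^+ 2) * legd l m y).

Lemma is_derive_Phat l m y : -1 < y -> y < 1 ->
  is_derive y 1 (Phat l m) (dPhat l m y).
Proof.
move=> y1 y2; have w2 := onem_sqr_gt0 _ y1 y2.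
pose q (t : R) := Num.sqrt (1 - t ^+ 2).
have q0 : q y != 0 by rewrite sqrtr_eq0 -ltNge.
have qq : q y ^+ 2 = 1 - y ^+ 2 by rewrite sqr_sqrtr // ltW.
have dq : is_derive y 1 q (- y / q y).
  have d1 : is_derive y 1 (fun t : R => 1 - t ^+ 2) (- (2 * y)).
    by apply: is_derive_eq; rewrite /GRing.scale /=; ring.
  have := @is_derive1_comp _ Num.sqrt (fun t : R => 1 - t ^+ 2) y _ _
    (is_derive1_sqrt w2) d1.
  by move=> h; apply: is_derive_eq; rewrite -/(q y); field.
have dl := is_derive_legd l m y.
apply: (@near_eq_is_derive _ _ _
   (fun t => (-1) ^+ m * q t ^+ m * legd l m t)).
  near=> t; rewrite PhatE //; near: t.
    exact: lt_nbhsr.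
  exact: lt_nbhsl.
have dX : is_derive y 1 (fun t => q t ^+ m)
    (- (m%:R * y / (1 - y ^+ 2)) * q y ^+ m).
  case: m {dl} => [|m].
    rewrite (_ : - _ * _ = 0); last by rewrite !mul0r oppr0 mul0r.
    exact: is_derive_cst.
  have := is_deriveX m.+1 dq; rewrite exprfctE => h; apply: (is_derive_eq h).
  rewrite -qq /GRing.scale /= [q y ^+ m.+1]exprS; by field.
have h := is_deriveM (is_deriveZ ((-1) ^+ m) dX) dl.
apply: (is_derive_eq h).
rewrite /dPhat -/(q y) -qq /GRing.scale /= -[_ *: q y ^+ m]/(_ * _).
by field.
Unshelve. all: by end_near.
Qed.

End AssocLegendre.

Section Ladders.
Context {R : realType} (y : R) (y1 : -1 < y) (y2 : y < 1).
Implicit Types (l m n d : nat).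
Let w : R := Num.sqrt (1 - y ^+ 2).
Let w2 : w ^+ 2 = 1 - y ^+ 2.
Proof. by rewrite sqr_sqrtr // ltW // onem_sqr_gt0. Qed.
Let w0 : w != 0.
Proof. by rewrite sqrtr_eq0 -ltNge onem_sqr_gt0. Qed.

(** The derivative of the factor w^m cancels against the second term, so only
    the derivative of the polynomial remains. *)
Lemma Phat_raise l m :
  w * dPhat l m y + m%:R * (y / w * Phat l m y) = - Phat l m.+1 y.
Proof. by rewrite !PhatE // /dPhat -/w -w2 !exprS; field. Qed.

(** Here the derivative of the factor w^m and the second term add up, to the
    first-order term of Legendre's equation. *)
Lemma Phat_lower l m :
  w * dPhat l m.+1 y - m.+1%:R * (y / w * Phat l m.+1 y) =
  (l + m).+1%:R * (l%:R - m%:R) * Phat l m y.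
Proof.
rewrite !PhatE // /dPhat -/w -w2; have := legd_ode l m y; rewrite -w2 => E.
transitivity ((-1) ^+ m * w ^+ m *
  (2 * m.+1%:R * y * legd l m.+1 y - w ^+ 2 * legd l m.+2 y)).
  by rewrite ![_ ^+ m.+1]exprS; field.
rewrite E; ring.
Qed.

Lemma Phat_next l m :
  - w ^+ 2 * dPhat l m y + l.+1%:R * y * Phat l m y =
  (l.+1%:R - m%:R) * Phat l.+1 m y.
Proof.
rewrite !PhatE // /dPhat -/w -w2; have := legd_climb l m y; rewrite -w2 => E.
transitivity ((-1) ^+ m * w ^+ m *
  ((l + m).+1%:R * y * legd l m y - w ^+ 2 * legd l m.+1 y)); first by field.
by rewrite E; ring.
Qed.

Lemma Phat_prev l m :
  - w ^+ 2 * dPhat l.+1 m y - l.+1%:R * y * Phat l.+1 m y =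
  - (l + m).+1%:R * Phat l m y.
Proof.
rewrite !PhatE // /dPhat -/w -w2; have := legd_descend l m y; rewrite -w2 => E.
transitivity (- ((-1) ^+ m * w ^+ m) *
  (w ^+ 2 * legd l.+1 m.+1 y + (l.+1%:R - m%:R) * y * legd l.+1 m y)).
  by field.
by rewrite E; ring.
Qed.

(** All powers of w below m + 1 cancel because of w^2 = 1 - y^2; the rest is
    [legd_up]. *)
Lemma Phat_raise_next l m :
  y * w * dPhat l m y + l.+1%:R * w * Phat l m y + m%:R * (w^-1 * Phat l m y) =
  - Phat l.+1 m.+1 y.
Proof.
rewrite !PhatE // /dPhat -/w -w2 [legd l.+1 _ _]legd_up ![_ ^+ m.+1]exprS.
apply/eqP; rewrite -subr_eq0; apply/eqP.
transitivity ((-1) ^+ m * w ^+ m * legd l m y * m%:R / w *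
  (1 - y ^+ 2 - w ^+ 2)).
  by field.
by rewrite w2 subrr mulr0.
Qed.

Lemma Phat_raise_prev l m :
  y * w * dPhat l.+1 m y - l.+1%:R * w * Phat l.+1 m y
    + m%:R * (w^-1 * Phat l.+1 m y) =
  - Phat l m.+1 y.
Proof.
rewrite !PhatE // /dPhat -/w -w2 [legd l _ _]legd_down ![_ ^+ m.+1]exprS.
apply/eqP; rewrite -subr_eq0; apply/eqP.
transitivity ((-1) ^+ m * w ^+ m * legd l.+1 m y * m%:R / w *
  (1 - y ^+ 2 - w ^+ 2)).
  by field.
by rewrite w2 subrr mulr0.
Qed.

(** The same cancellation as in the raising relation leaves
    2(m+1) P_l^(m+1) - (1 - y^2) P_(l+1)^(m+2), which Legendre's equation in
    degree l + 1 and [legd_down] reduce to a multiple of P_(l+1)^(m). *)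
Lemma Phat_lower_next l m :
  y * w * dPhat l m.+1 y + l.+1%:R * w * Phat l m.+1 y
    - m.+1%:R * (w^-1 * Phat l m.+1 y) =
  (l%:R - m%:R) * (l.+1%:R - m%:R) * Phat l.+1 m y.
Proof.
transitivity (((-1) ^+ m * w ^+ m) *
  (2 * m.+1%:R * legd l m.+1 y - (1 - y ^+ 2) * legd l.+1 m.+2 y)).
  rewrite !PhatE // /dPhat -/w -w2 [legd l.+1 _ _]legd_up ![_ ^+ m.+1]exprS.
  apply/eqP; rewrite -subr_eq0; apply/eqP.
  transitivity ((-1) ^+ m * w ^+ m * legd l m.+1 y * m.+1%:R *
    (w ^+ 2 - (1 - y ^+ 2))).
    by field.
  by rewrite w2 subrr mulr0.
rewrite legd_ode legd_down PhatE // -/w; ring.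
Qed.

Lemma Phat_lower_prev l m :
  y * w * dPhat l.+1 m.+1 y - l.+1%:R * w * Phat l.+1 m.+1 y
    - m.+1%:R * (w^-1 * Phat l.+1 m.+1 y) =
  (l + m).+1%:R * (l + m).+2%:R * Phat l m y.
Proof.
transitivity (((-1) ^+ m * w ^+ m) *
  (2 * m.+1%:R * legd l.+1 m.+1 y - (1 - y ^+ 2) * legd l m.+2 y)).
  rewrite !PhatE // /dPhat -/w -w2 [legd l m.+2 _]legd_down ![_ ^+ m.+1]exprS.
  apply/eqP; rewrite -subr_eq0; apply/eqP.
  transitivity ((-1) ^+ m * w ^+ m * legd l.+1 m.+1 y * m.+1%:R *
    (w ^+ 2 - (1 - y ^+ 2))).
    by field.
  by rewrite w2 subrr mulr0.
rewrite legd_ode legd_up PhatE // -/w; ring.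
Qed.

End Ladders.

(** * Normalised ladder relations *)

Section Normalised.
Context {R : realType} (y : R) (y1 : -1 < y) (y2 : y < 1).
Implicit Types (l m n d s : nat).
Let w : R := Num.sqrt (1 - y ^+ 2).

Definition sqrtn n : R := Num.sqrt n%:R.

Lemma sqrtnM a b : sqrtn (a * b) = sqrtn a * sqrtn b.
Proof. by rewrite /sqrtn natrM sqrtrM. Qed.

Lemma sqr_sqrtn a : a%:R = sqrtn a ^+ 2 :> R.
Proof. by rewrite sqr_sqrtr. Qed.

(** The normalising factor in terms of d = l - m and s = l + m. In these
    variables each ladder step is a composition of unit shifts, each of which
    contributes a single square root. *)
Definition nrm d s : R := Num.sqrt (d`!%:R / s`!%:R).

Lemma nrmSl d s : nrm d.+1 s = sqrtn d.+1 * nrm d s.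
Proof. by rewrite /nrm /sqrtn factS natrM -mulrA sqrtrM. Qed.

Lemma nrmSr d s : nrm d s = sqrtn s.+1 * nrm d s.+1.
Proof.
rewrite /nrm /sqrtn -sqrtrM //; congr Num.sqrt; rewrite factS natrM.
by field; rewrite nat1r !pnatr_eq0 -!lt0n fact_gt0.
Qed.

Lemma Pcheck_nrm l m d s : (l - m)%N = d -> (l + m)%N = s ->
  Pcheck l m y = nrm d s * Phat l m y.
Proof. by rewrite /Pcheck => -> ->. Qed.

Lemma Phat_gt l m : (l < m)%N -> Phat l m y = 0.
Proof. by move=> lm; rewrite PhatE // legd_gt // mulr0. Qed.

Lemma Pcheck_gt l m : (l < m)%N -> Pcheck l m y = 0.
Proof. by move=> lm; rewrite /Pcheck Phat_gt // mulr0. Qed.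

Definition dPcheck l m : R :=
  Num.sqrt ((l - m)`!%:R / (l + m)`!%:R) * dPhat l m y.

Lemma dPcheck_nrm l m d s : (l - m)%N = d -> (l + m)%N = s ->
  dPcheck l m = nrm d s * dPhat l m y.
Proof. by rewrite /dPcheck => -> ->. Qed.

(** Not [Pcheck l.-1]: for l = 0 the degree is -1, where the convention is the
    zero function. *)
Definition Pprev l m : R := if l is l'.+1 then Pcheck l' m y else 0.

(** Split into two factors over the natural numbers, these constants match the
    two unit shifts of [nrm] that make up a ladder step. *)
Lemma hE (l m : int) (a b : nat) : l + m = a -> l - m = b ->
  h l m = sqrtn a * sqrtn b.
Proof. by move=> ea eb; rewrite /h ea eb -sqrtnM. Qed.

Lemma htildeE (l m : int) (a b : nat) : l + m = a -> l + m + 1 = b ->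
  htilde l m = sqrtn a * sqrtn b.
Proof. by move=> ea eb; rewrite /htilde eb ea -sqrtnM. Qed.

Lemma hhatE (l m : int) (a b : nat) : l + m = a -> l - m + 1 = b ->
  hhat l m = sqrtn a * sqrtn b.
Proof. by move=> ea eb; rewrite /hhat ea eb -sqrtnM. Qed.

Lemma natr_subn l m d : (m + d)%N = l -> l%:R - m%:R = d%:R :> R.
Proof. by move=> <-; rewrite natrD addrAC subrr add0r. Qed.

(** The target of this relation, like those of [Pcheck_prev] and
    [Pcheck_raise_prev], can have an order above its degree. The recursion for
    the normalising factor stops there, but then both sides are zero; this is
    the case distinction on l - m in the proofs. *)
Lemma Pcheck_raise l m : (m <= l)%N ->
  w * dPcheck l m + m%:R * (y / w * Pcheck l m y) =
  - (hhat l (- m%:Z) * Pcheck l m.+1 y).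
Proof.
move=> /subnKC; move: (l - m)%N => d El.
rewrite (@Pcheck_nrm _ _ d (l + m)) ?(@dPcheck_nrm _ _ d (l + m)); try lia.
transitivity (nrm d (l + m) *
  (w * dPhat l m y + m%:R * (y / w * Phat l m y))); first by ring.
rewrite Phat_raise //.
case: d El => [|d] El; first
  by rewrite Phat_gt ?Pcheck_gt ?oppr0 ?mulr0 ?oppr0 //; lia.
rewrite nrmSl nrmSr (@Pcheck_nrm _ _ d (l + m).+1); try lia.
rewrite (@hhatE _ _ d.+1 (l + m).+1); try lia.
ring.
Qed.

Lemma Pcheck_lower l m : (m.+1 <= l)%N ->
  w * dPcheck l m.+1 - m.+1%:R * (y / w * Pcheck l m.+1 y) =
  hhat l m.+1 * Pcheck l m y.
Proof.
move=> /subnKC; move: (l - m.+1)%N => d El.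
rewrite (@Pcheck_nrm _ m.+1 d (l + m).+1)
  ?(@dPcheck_nrm _ _ d (l + m).+1); try lia.
transitivity (nrm d (l + m).+1 *
  (w * dPhat l m.+1 y - m.+1%:R * (y / w * Phat l m.+1 y))); first by ring.
rewrite Phat_lower // (@natr_subn _ _ d.+1); last lia.
rewrite (@Pcheck_nrm _ _ d.+1 (l + m)); try lia.
rewrite nrmSl [nrm d (l + m)]nrmSr.
rewrite (@hhatE _ _ (l + m).+1 d.+1); try lia.
rewrite [(l + m).+1%:R]sqr_sqrtn [d.+1%:R]sqr_sqrtn; ring.
Qed.

Lemma Pcheck_next l m : (m <= l)%N ->
  - w ^+ 2 * dPcheck l m + l.+1%:R * y * Pcheck l m y =
  h (l%:Z + 1) m%:Z * Pcheck l.+1 m y.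
Proof.
move=> /subnKC; move: (l - m)%N => d El.
rewrite (@Pcheck_nrm _ m d (l + m)) ?(@dPcheck_nrm _ _ d (l + m)); try lia.
transitivity (nrm d (l + m) *
  (- w ^+ 2 * dPhat l m y + l.+1%:R * y * Phat l m y)); first by ring.
rewrite Phat_next // (@natr_subn _ _ d.+1); last lia.
rewrite (@Pcheck_nrm _ _ d.+1 (l + m).+1); try lia.
rewrite nrmSl [nrm d (l + m)]nrmSr.
rewrite (@hE _ _ (l + m).+1 d.+1); try lia.
rewrite [d.+1%:R]sqr_sqrtn; ring.
Qed.

Lemma Pcheck_prev l m : (m <= l)%N ->
  - w ^+ 2 * dPcheck l m - l%:R * y * Pcheck l m y =
  - (h l m * Pprev l m).
Proof.
case: l => [|l].
  rewrite leqn0 => /eqP -> /=.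
  by rewrite /dPcheck /dPhat legd_gt //; ring.
move=> /subnKC; move: (l.+1 - m)%N => d El.
rewrite (@Pcheck_nrm _ m d (l + m).+1)
  ?(@dPcheck_nrm _ _ d (l + m).+1); try lia.
transitivity (nrm d (l + m).+1 *
  (- w ^+ 2 * dPhat l.+1 m y - l.+1%:R * y * Phat l.+1 m y)); first by ring.
rewrite Phat_prev //=.
case: d El => [|d] El; first
  by rewrite Phat_gt ?Pcheck_gt ?oppr0 ?mulr0 ?oppr0 //; lia.
rewrite (@Pcheck_nrm _ _ d (l + m)); try lia.
rewrite nrmSl [nrm d (l + m)]nrmSr.
rewrite (@hE _ _ (l + m).+1 d.+1); try lia.
rewrite [(l + m).+1%:R]sqr_sqrtn; ring.
Qed.

Lemma Pcheck_raise_next l m : (m <= l)%N ->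
  y * w * dPcheck l m + l.+1%:R * w * Pcheck l m y
    + m%:R * (w^-1 * Pcheck l m y) =
  - (htilde (l%:Z + 1) m%:Z * Pcheck l.+1 m.+1 y).
Proof.
move=> /subnKC; move: (l - m)%N => d El.
rewrite (@Pcheck_nrm _ m d (l + m)) ?(@dPcheck_nrm _ _ d (l + m)); try lia.
transitivity (nrm d (l + m) *
  (y * w * dPhat l m y + l.+1%:R * w * Phat l m y
    + m%:R * (w^-1 * Phat l m y))); first by ring.
rewrite Phat_raise_next // (@Pcheck_nrm _ _ d (l + m).+2); try lia.
rewrite (@htildeE _ _ (l + m).+1 (l + m).+2); try lia.
rewrite 2!nrmSr; ring.
Qed.

Lemma Pcheck_lower_next l m : (m.+1 <= l)%N ->
  y * w * dPcheck l m.+1 + l.+1%:R * w * Pcheck l m.+1 y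
    - m.+1%:R * (w^-1 * Pcheck l m.+1 y) =
  htilde (l%:Z + 1) (- m.+1%:Z) * Pcheck l.+1 m y.
Proof.
move=> /subnKC; move: (l - m.+1)%N => d El.
rewrite (@Pcheck_nrm _ m.+1 d (l + m).+1)
  ?(@dPcheck_nrm _ _ d (l + m).+1); try lia.
transitivity (nrm d (l + m).+1 *
  (y * w * dPhat l m.+1 y + l.+1%:R * w * Phat l m.+1 y
    - m.+1%:R * (w^-1 * Phat l m.+1 y))); first by ring.
rewrite Phat_lower_next // (@natr_subn _ _ d.+1)
  1?(@natr_subn _ _ d.+2); try lia.
rewrite (@Pcheck_nrm _ _ d.+2 (l + m).+1); try lia.
rewrite (@htildeE _ _ d.+1 d.+2); try lia.
rewrite !nrmSl [d.+1%:R]sqr_sqrtn [d.+2%:R]sqr_sqrtn; ring.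
Qed.

Lemma Pcheck_raise_prev l m : (m <= l)%N ->
  y * w * dPcheck l m - l%:R * w * Pcheck l m y
    + m%:R * (w^-1 * Pcheck l m y) =
  - (htilde (l%:Z - 1) (- m%:Z) * Pprev l m.+1).
Proof.
case: l => [|l].
  rewrite leqn0 => /eqP -> /=.
  by rewrite /dPcheck /dPhat legd_gt //; ring.
move=> /subnKC; move: (l.+1 - m)%N => d El.
rewrite (@Pcheck_nrm _ m d (l + m).+1)
  ?(@dPcheck_nrm _ _ d (l + m).+1); try lia.
transitivity (nrm d (l + m).+1 *
  (y * w * dPhat l.+1 m y - l.+1%:R * w * Phat l.+1 m y
    + m%:R * (w^-1 * Phat l.+1 m y))); first by ring.
rewrite Phat_raise_prev //=.
case: d El => [|[|d]] El; try
  by rewrite Phat_gt ?Pcheck_gt ?oppr0 ?mulr0 ?oppr0 //; lia.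
rewrite (@Pcheck_nrm _ _ d (l + m).+1); try lia.
rewrite (@htildeE _ _ d.+1 d.+2); try lia.
rewrite !nrmSl; ring.
Qed.

Lemma Pcheck_lower_prev l m : (m.+1 <= l)%N ->
  y * w * dPcheck l m.+1 - l%:R * w * Pcheck l m.+1 y
    - m.+1%:R * (w^-1 * Pcheck l m.+1 y) =
  htilde (l%:Z - 1) m.+1%:Z * Pprev l m.
Proof.
case: l => [//|l].
move=> /subnKC; move: (l.+1 - m.+1)%N => d El.
rewrite (@Pcheck_nrm _ m.+1 d (l + m).+2)
  ?(@dPcheck_nrm _ _ d (l + m).+2); try lia.
transitivity (nrm d (l + m).+2 *
  (y * w * dPhat l.+1 m.+1 y - l.+1%:R * w * Phat l.+1 m.+1 y
    - m.+1%:R * (w^-1 * Phat l.+1 m.+1 y))); first by ring.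
rewrite Phat_lower_prev //=.
rewrite (@Pcheck_nrm _ _ d (l + m)); try lia.
rewrite (@htildeE _ _ (l + m).+1 (l + m).+2); try lia.
rewrite [nrm d (l + m)]nrmSr [nrm d (l + m).+1]nrmSr.
rewrite [(l + m).+1%:R]sqr_sqrtn [(l + m).+2%:R]sqr_sqrtn; ring.
Qed.
End Normalised.

(** * The azimuthal factor *)

Section Angular.
Context {R : realType}.
Implicit Types (m : int) (phi : R).

Definition azimuth m phi : R :=
  if m < 0 then Num.sqrt 2 * sin (`|m|%:~R * phi)
  else if m == 0 then 1 else Num.sqrt 2 * cos (m%:~R * phi).

Lemma azimuth0 phi : azimuth 0 phi = 1. Proof. by []. Qed.
Lemma azimuthS (k : nat) phi : azimuth k.+1%:Z phi =
  Num.sqrt 2 * cos (k.+1%:R * phi).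
Proof. by []. Qed.
Lemma azimuthN (k : nat) phi : azimuth (- k.+1%:Z) phi =
  Num.sqrt 2 * sin (k.+1%:R * phi).
Proof. by []. Qed.

(** By the addition formulas, cos phi and sin phi times the factors of index m
    and -m are combinations of those of index m - 1 and m + 1 (or of their
    opposites). The coefficients that arise are C - m D and C + m D, which the
    hypotheses evaluate. For |m| > 1 this is uniform up to a sign; for |m| <= 1
    the factor sqrt 2 is missing at the index 0, which is what the square roots
    in the constants compensate, and the zeros of [shat] at -1 and of [stilde]
    at 1 stand for a vanishing sin (0 phi). At m = 0 a lowered order makes
    no sense, and the constants in front of [U] are zero. *)
Lemma ladder_trig (C D U V phi : R) (m : int) :
  C + m%:~R * D = - (sign m * V) ->
  (m != 0 -> C - m%:~R * D = sign m * U) ->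
  cos phi * C * azimuth m phi - m%:~R * sin phi * D * azimuth (- m) phi =
    1 / 2 * (scheck m * U * azimuth (m - 1) phi
             - shat m * V * azimuth (m + 1) phi)
  /\
  sin phi * C * azimuth m phi + m%:~R * cos phi * D * azimuth (- m) phi =
    - (1 / 2) * (stilde m * U * azimuth (- m + 1) phi
                 + s m * V * azimuth (- m - 1) phi).
Proof.
pose sgnE := (subr0, subrr, addr0, add0r, mulr0, mul0r, mulr1, mul1r, sqrtr1).
have r2 : Num.sqrt 2 * Num.sqrt 2 = 2 :> R by rewrite -expr2 sqr_sqrtr.
have cs := cos2Dsin2 phi.
have thetaS (k : nat) : k.+1%:R * phi = k%:R * phi + phi.
  by rewrite -natr1 mulrDl mul1r.
have thetaP (k : nat) : k%:R * phi = k.+1%:R * phi - phi.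
  by rewrite thetaS addrK.
case: m => [[|[|k]]|[|k]].
- have -> : scheck 0 = 0 :> R by rewrite /scheck /sign /delta /= !sgnE.
  have -> : shat 0 = Num.sqrt 2 :> R by rewrite /shat /sign /delta /= !sgnE.
  have -> : stilde 0 = 0 :> R by rewrite /stilde /sign /delta /= !sgnE.
  have -> : s 0 = Num.sqrt 2 :> R by rewrite /s /sign /delta /= !sgnE.
  have -> : - 0 - 1 = - 1%:Z :> int by [].
  have -> : 0 + 1 = 1%:Z :> int by [].
  rewrite azimuth0 azimuthN azimuthS !mul1r /sign /= => h _.
  have {h} -> : C = - V by move: h; rewrite mulr0z mul0r addr0.
  set r := Num.sqrt 2 in r2 *.
  split.
    by transitivity (- (V * cos phi) * (r * r) / 2);
    [rewrite r2; field|field].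
  by transitivity (- (V * sin phi) * (r * r) / 2);
    [rewrite r2; field|field].
- have -> : scheck 1 = Num.sqrt 2 :> R by rewrite /scheck /sign /delta /= !sgnE.
  have -> : shat 1 = 1 :> R by rewrite /shat /sign /delta /= !sgnE.
  have -> : stilde 1 = 0 :> R by rewrite /stilde /sign /delta /= !sgnE.
  have -> : s 1 = 1 :> R by rewrite /s /sign /delta /= !sgnE.
  have -> : 1%:Z - 1 = 0 :> int by [].
  have -> : 1%:Z + 1 = 2%:Z :> int by [].
  have -> : - 1%:Z - 1 = - 2%:Z :> int by [].
  rewrite azimuth0 !azimuthN !azimuthS /sign /= => h1 /(_ isT) h2.
  have eU : U = C - D by lra.
  have eV : V = - (C + D) by lra.
  rewrite [2%:R * _]thetaS !mul1r sinD cosD eU eV.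
  set r := Num.sqrt 2.
  split; last by field.
  transitivity (1 / 2 * r *
    ((C - D) * (cos phi ^+ 2 + sin phi ^+ 2) +
    (C + D) * (cos phi ^+ 2 - sin phi ^+ 2))).
    by field.
  by rewrite cs; field.
- have -> : scheck k.+2 = 1 :> R by rewrite /scheck /sign /delta /= !sgnE.
  have -> : shat k.+2 = 1 :> R by rewrite /shat /sign /delta /= !sgnE.
  have -> : stilde k.+2 = 1 :> R by rewrite /stilde /sign /delta /= !sgnE.
  have -> : s k.+2 = 1 :> R by rewrite /s /sign /delta /= !sgnE.
  have -> : k.+2%:Z - 1 = k.+1%:Z :> int by lia.
  have -> : k.+2%:Z + 1 = k.+3%:Z :> int by lia.
  have -> : - k.+2%:Z + 1 = - k.+1%:Z :> int by lia.
  have -> : - k.+2%:Z - 1 = - k.+3%:Z :> int by lia.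
  rewrite !azimuthN !azimuthS /sign /= => h1 /(_ isT) h2.
  have eU : U = C - k.+2%:R * D by lra.
  have eV : V = - (C + k.+2%:R * D) by lra.
  rewrite [k.+3%:R * _]thetaS [k.+1%:R * _]thetaP sinB cosB sinD cosD eU eV.
  by split; field.
- have -> : scheck (Negz 0) = -1 :> R
    by rewrite /scheck /sign /delta /= !sgnE.
  have -> : shat (Negz 0) = 0 :> R by rewrite /shat /sign /delta /= !sgnE.
  have -> : stilde (Negz 0) = -1 :> R
    by rewrite /stilde /sign /delta /= !sgnE.
  have -> : s (Negz 0) = - Num.sqrt 2 :> R.
    by rewrite /s /sign /delta /= !sgnE mulN1r.
  have -> : Negz 0 = - 1%:Z by [].
  have -> : - 1%:Z - 1 = - 2%:Z :> int by [].
  have -> : - - 1%:Z = 1%:Z :> int by [].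
  have -> : 1%:Z - 1 = 0 :> int by [].
  have -> : 1%:Z + 1 = 2%:Z :> int by [].
  rewrite azimuth0 !azimuthN !azimuthS /sign /= => h1 /(_ isT) h2.
  have eU : U = - (C + D) by lra.
  have eV : V = C - D by lra.
  rewrite [2%:R * _]thetaS !mul1r sinD cosD eU eV.
  set r := Num.sqrt 2.
  split; first by field.
  transitivity (1 / 2 * r *
    ((C - D) * (cos phi ^+ 2 + sin phi ^+ 2) -
    (C + D) * (cos phi ^+ 2 - sin phi ^+ 2))).
    by field.
  by rewrite cs; field.
- have -> : scheck (Negz k.+1) = -1 :> R
    by rewrite /scheck /sign /delta /= !sgnE.
  have -> : shat (Negz k.+1) = -1 :> R by rewrite /shat /sign /delta /= !sgnE.
  have -> : stilde (Negz k.+1) = -1 :> R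
    by rewrite /stilde /sign /delta /= !sgnE.
  have -> : s (Negz k.+1) = -1 :> R by rewrite /s /sign /delta /= !sgnE.
  rewrite NegzE opprK.
  have -> : k.+2%:Z - 1 = k.+1%:Z :> int by lia.
  have -> : k.+2%:Z + 1 = k.+3%:Z :> int by lia.
  have -> : - k.+2%:Z + 1 = - k.+1%:Z :> int by lia.
  have -> : - k.+2%:Z - 1 = - k.+3%:Z :> int by lia.
  rewrite !azimuthN !azimuthS /sign /= mulrNz => h1 /(_ isT) h2.
  have eU : U = - (C + k.+2%:R * D) by lra.
  have eV : V = C - k.+2%:R * D by lra.
  rewrite [k.+3%:R * _]thetaS [k.+1%:R * _]thetaP sinB cosB sinD cosD eU eV.
  by split; field.
Qed.
End Angular.

(** * Real spherical harmonics *)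

Section Harmonics.
Context {R : realType}.
Implicit Types (m : int) (l k j : nat) (y phi : R).

(** For negative [m], C + m D is C - |m| D: the relations raising and lowering
    the order |m| exchange their roles. This is the same as shifting the signed
    index, at the price of a sign. *)
Lemma signed_ladder (f : int -> R) (B : nat -> R) (C D : R) (m : int) :
  C + (absz m)%:R * D = - (f (- (absz m)%:Z) * B (absz m).+1) ->
  (forall j, absz m = j.+1 -> C - (absz m)%:R * D = f (absz m)%:Z * B j) ->
  C + m%:~R * D = - (sign m * (f (- m) * B (absz (m + 1)))) /\
  (m != 0 -> C - m%:~R * D = sign m * (f m * B (absz (m - 1)))).
Proof.
rewrite /sign; case: m => k.
  rewrite -[absz k]/k -[0 <= _]/true => hr hl; split.
    by rewrite mul1r (_ : absz _ = k.+1) -?hr //; lia.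
  case: k hr hl => [|k] // _ hl _.
  rewrite mul1r (_ : absz _ = k); last lia.
  by rewrite -(hl _ erefl).
rewrite -[absz (Negz k)]/k.+1 -[0 <= _]/false => hr hl; split; last first.
  move=> _; rewrite (_ : absz _ = k.+2); last lia.
  by rewrite mulN1r NegzE -hr mulrNz mulNr opprK.
rewrite (_ : absz _ = k); last lia.
by rewrite mulN1r NegzE !opprK -(hl _ erefl) mulrNz mulNr.
Qed.

(** The condition |m| <= l in the definition of [Y] is automatic on the
    right-hand side, because the associated Legendre function is zero beyond
    it. *)
Lemma Y_azimuthE l m y phi : -1 < y -> y < 1 ->
  Y l%:Z m y phi = Pcheck l (absz m) y * azimuth m phi.
Proof.
move=> y1 y2; rewrite /Y /azimuth; case: ifP => ml; last first.
  by rewrite Pcheck_gt ?mul0r //; lia.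
case: ifP => m0; first by ring.
case: ifP => [/eqP ->|_]; first by rewrite mulr1.
by ring.
Qed.

Lemma Y_pred_azimuthE l m y phi : -1 < y -> y < 1 ->
  Y (l%:Z - 1) m y phi = Pprev y l (absz m) * azimuth m phi.
Proof.
move=> y1 y2; case: l => [|l].
  by rewrite /= mul0r /Y (_ : (`|m| <= 0%:Z - 1) = false) //; lia.
by rewrite (_ : l.+1%:Z - 1 = l%:Z) ?Y_azimuthE //; lia.
Qed.

Lemma is_derive_Y l m y phi : -1 < y -> y < 1 -> (absz m <= l)%N ->
  is_derive y 1 (fun t => Y l%:Z m t phi)
    (dPcheck y l (absz m) * azimuth m phi).
Proof.
move=> y1 y2 ml.
pose c : R := Num.sqrt ((l - absz m)`!%:R / (l + absz m)`!%:R) * azimuth m phi.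
have -> : (fun t => Y l%:Z m t phi) = c \*: Phat l (absz m).
  apply/funext => t; rewrite /Y ifT; last lia.
  rewrite -[RHS]/(c * Phat l (absz m) t) /c /azimuth /Pcheck.
  case: ifP => _; first by ring.
  case: ifP => [/eqP ->|_]; first by rewrite mulr1.
  by ring.
have h := is_deriveZ c (is_derive_Phat l (absz m) _ y1 y2).
by apply: (is_derive_eq h); rewrite -[_ *: _]/(_ * _) /dPcheck /c; ring.
Qed.

(** Two trigonometric identities for every pair of ladder relations; [f] is the
    coefficient of the pair, and [B] the target function as a function of the
    order. *)
Lemma Y_ladder (f : int -> R) (B : nat -> R) (C D phi : R) (m : int) :
  C + (absz m)%:R * D = - (f (- (absz m)%:Z) * B (absz m).+1) ->
  (forall j, absz m = j.+1 -> C - (absz m)%:R * D = f (absz m)%:Z * B j) ->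
  cos phi * C * azimuth m phi - m%:~R * sin phi * D * azimuth (- m) phi =
    1 / 2 * (scheck m * f m * (B (absz (m - 1)) * azimuth (m - 1) phi)
             - shat m * f (- m) * (B (absz (m + 1)) * azimuth (m + 1) phi))
  /\
  sin phi * C * azimuth m phi + m%:~R * cos phi * D * azimuth (- m) phi =
    - (1 / 2) *
      (stilde m * f m * (B (absz (- m + 1)) * azimuth (- m + 1) phi)
       + s m * f (- m) * (B (absz (- m - 1)) * azimuth (- m - 1) phi)).
Proof.
move=> hr hl; have [Hr Hl] := signed_ladder _ _ _ _ _ hr hl.
have [-> ->] := ladder_trig _ _ _ _ phi _ Hr Hl.
rewrite (_ : absz (- m + 1) = absz (m - 1)); last lia.
rewrite (_ : absz (- m - 1) = absz (m + 1)); last lia.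
by split; ring.
Qed.

Lemma h_absz (l m : int) : h l m = h l (absz m)%:Z :> R.
Proof.
case: m => // k; rewrite NegzE /h /= opprK mulrC.
by congr (Num.sqrt _%:~R); ring.
Qed.

End Harmonics.

Theorem theorem4p1 (R : realType) (l m : int) (y phi : R)
    (hl : 0 <= l) (hm : `|m| <= l) (hy1 : -1 < y) (hy2 : y < 1) :
  (I0 y phi * Y l m y phi =
     1 / (2 * l + 1)%:~R *
       (h (l + 1) m * Y (l + 1) m y phi + h l m * Y (l - 1) m y phi)
   /\
   I1 y phi * Y l m y phi =
     1 / (2 * (2 * l + 1))%:~R *
       (scheck m * (htilde (l + 1) (- m) * Y (l + 1) (m - 1) y phi
                    - htilde (l - 1) m * Y (l - 1) (m - 1) y phi)
        - shat m * (htilde (l + 1) m * Y (l + 1) (m + 1) y phi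
                    - htilde (l - 1) (- m) * Y (l - 1) (m + 1) y phi))
   /\
   I2 y phi * Y l m y phi =
     1 / (2 * (2 * l + 1))%:~R *
       (s m * (htilde (l - 1) (- m) * Y (l - 1) (- m - 1) y phi
               - htilde (l + 1) m * Y (l + 1) (- m - 1) y phi)
        + stilde m * (htilde (l - 1) m * Y (l - 1) (- m + 1) y phi
                      - htilde (l + 1) (- m) * Y (l + 1) (- m + 1) y phi)))
  /\
  (derivable (fun t : R => Y l m t phi) y 1
   /\
   Itilde0 y phi * dY l m y phi - l%:~R * I0 y phi * Y l m y phi =
     - h l m * Y (l - 1) m y phi
   /\
   Itilde0 y phi * dY l m y phi + (l + 1)%:~R * I0 y phi * Y l m y phi =
     h (l + 1) m * Y (l + 1) m y phi
   /\
   Itilde1 y phi * dY l m y phi - l%:~R * I1 y phi * Y l m y phi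
     - m%:~R * Ihat1 y phi * Y l (- m) y phi =
     1 / 2 * (scheck m * htilde (l - 1) m * Y (l - 1) (m - 1) y phi
              - shat m * htilde (l - 1) (- m) * Y (l - 1) (m + 1) y phi)
   /\
   Itilde2 y phi * dY l m y phi - l%:~R * I2 y phi * Y l m y phi
     - m%:~R * Ihat2 y phi * Y l (- m) y phi =
     - (1 / 2) * (stilde m * htilde (l - 1) m * Y (l - 1) (- m + 1) y phi
                  + s m * htilde (l - 1) (- m) * Y (l - 1) (- m - 1) y phi)
   /\
   Itilde1 y phi * dY l m y phi + (l + 1)%:~R * I1 y phi * Y l m y phi
     - m%:~R * Ihat1 y phi * Y l (- m) y phi =
     1 / 2 * (scheck m * htilde (l + 1) (- m) * Y (l + 1) (m - 1) y phi
              - shat m * htilde (l + 1) m * Y (l + 1) (m + 1) y phi)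
   /\
   Itilde2 y phi * dY l m y phi + (l + 1)%:~R * I2 y phi * Y l m y phi
     - m%:~R * Ihat2 y phi * Y l (- m) y phi =
     - (1 / 2) * (stilde m * htilde (l + 1) (- m) * Y (l + 1) (- m + 1) y phi
                  + s m * htilde (l + 1) m * Y (l + 1) (- m - 1) y phi)
   /\
   I1 y phi * dY l m y phi - m%:~R * Ihat3 y phi * Y l (- m) y phi =
     1 / 2 * (scheck m * hhat l m * Y l (m - 1) y phi
              - shat m * hhat l (- m) * Y l (m + 1) y phi)
   /\
   I2 y phi * dY l m y phi - m%:~R * Ihat4 y phi * Y l (- m) y phi =
     - (1 / 2) * (stilde m * hhat l m * Y l (- m + 1) y phi
                  + s m * hhat l (- m) * Y l (- m - 1) y phi)).
Proof.
case: l hl hm => [l|//] _ hm.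
have {}hm : (absz m <= l)%N by lia.
have w2 : Num.sqrt (1 - y ^+ 2) ^+ 2 = 1 - y ^+ 2.
  by rewrite sqr_sqrtr // ltW // onem_sqr_gt0.
have w0 : Num.sqrt (1 - y ^+ 2) != 0.
  by rewrite sqrtr_eq0 -ltNge onem_sqr_gt0.
have wV : (1 - y ^+ 2) `^ (- (1 / 2)) = (Num.sqrt (1 - y ^+ 2))^-1.
  by rewrite powRN div1r powR12_sqrt // ltW // onem_sqr_gt0.
have dYE : is_derive y 1 (fun t => Y l m t phi)
    (dPcheck y l (absz m) * azimuth m phi).
  exact: is_derive_Y.
have l1 : l%:Z + 1 = l.+1%:Z by rewrite -addn1.
set w := Num.sqrt (1 - y ^+ 2) in w2 w0 wV *.
set k := absz m in hm dYE *.
have [||same1 same2] := @Y_ladder _ (hhat l) (fun j => Pcheck l j y)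
    (w * dPcheck y l k) (y / w * Pcheck l k y) phi m.
- by rewrite Pcheck_raise.
- by move=> j kj; rewrite /k kj Pcheck_lower // -kj.
have [||next1 next2] := @Y_ladder _ (fun n => htilde (l%:Z + 1) (- n))
    (fun j => Pcheck l.+1 j y)
    (y * w * dPcheck y l k + l.+1%:R * w * Pcheck l k y)
    (w^-1 * Pcheck l k y) phi m.
- by rewrite opprK Pcheck_raise_next.
- by move=> j kj; rewrite /k kj Pcheck_lower_next // -kj.
have [||prev1 prev2] := @Y_ladder _ (htilde (l%:Z - 1)) (Pprev y l)
    (y * w * dPcheck y l k - l%:R * w * Pcheck l k y)
    (w^-1 * Pcheck l k y) phi m.
- by rewrite Pcheck_raise_prev.
- by move=> j kj; rewrite /k kj Pcheck_lower_prev // -kj.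
rewrite !opprK in next1 next2.
have := Pcheck_next _ hy1 hy2 _ _ hm; rewrite -/w -(h_absz _ m) => next0.
have := Pcheck_prev _ hy1 hy2 _ _ hm; rewrite -/w -(h_absz _ m) => prev0.
have YS n : Y (l%:Z + 1) n y phi = Pcheck l.+1 (absz n) y * azimuth n phi.
  by rewrite l1 Y_azimuthE.
have kN : absz (- m) = k by rewrite abszN.
have l1R : (l%:Z + 1)%:~R = l.+1%:R :> R by rewrite l1.
have twolR : (2 * l%:Z + 1)%:~R = 2 * l%:R + 1 :> R by rewrite intrD intrM.
have twol_neq0 : 2 * l%:R + 1 != 0 :> R.
  by rewrite gt_eqF // ltr_wpDl // mulr_ge0 // ler0n.
rewrite /dY derive1E derive_val -!(pmulrn _ l).
rewrite [(2 * (_ + 1))%:~R]intrM twolR l1R.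
rewrite /I0 /I1 /I2 /Itilde0 /Itilde1 /Itilde2 /Ihat1 /Ihat2 /Ihat3 /Ihat4.
rewrite -!/w wV !Y_pred_azimuthE // !YS !Y_azimuthE // kN -/k.
have -> : y ^+ 2 - 1 = - w ^+ 2 by rewrite w2 opprB.
(* In the product identities the raising relation minus the lowering one
   leaves 2l + 1 times the product. *)
split; [split; [|split]|].
- transitivity (1 / (2 * l%:R + 1) *
    ((h (l%:Z + 1) m * Pcheck l.+1 k y - - (h l m * Pprev y l k))
     * azimuth m phi)).
    by rewrite -next0 -prev0; field.
  by rewrite opprK; ring.
- transitivity (1 / (2 * l%:R + 1) *
   ((cos phi * (y * w * dPcheck y l k + l.+1%:R * w * Pcheck l k y) *
    azimuth m phi
    - m%:~R * sin phi * (w^-1 * Pcheck l k y) * azimuth (- m) phi) -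
    (cos phi * (y * w * dPcheck y l k - l%:R * w * Pcheck l k y) *
    azimuth m phi
    - m%:~R * sin phi * (w^-1 * Pcheck l k y) * azimuth (- m) phi))).
    by field; rewrite w0.
  by rewrite next1 prev1; field.
- transitivity (1 / (2 * l%:R + 1) *
   ((sin phi * (y * w * dPcheck y l k + l.+1%:R * w * Pcheck l k y) *
    azimuth m phi
    + m%:~R * cos phi * (w^-1 * Pcheck l k y) * azimuth (- m) phi) -
    (sin phi * (y * w * dPcheck y l k - l%:R * w * Pcheck l k y) *
    azimuth m phi
    + m%:~R * cos phi * (w^-1 * Pcheck l k y) * azimuth (- m) phi))).
    by field; rewrite w0.
  by rewrite next2 prev2; field.
split; first by case: dYE.
split.
  transitivity (- (h l m * Pprev y l k) * azimuth m phi); last by ring.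
  by rewrite -prev0; ring.
split.
  transitivity (h (l%:Z + 1) m * Pcheck l.+1 k y * azimuth m phi); last by ring.
  by rewrite -next0; ring.
split; first by apply: etrans prev1; ring.
split; first by apply: etrans prev2; ring.
split; first by apply: etrans next1; ring.
split; first by apply: etrans next2; ring.
split; first by apply: etrans same1; ring.
by apply: etrans same2; ring.
Qed.
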